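(* Let $X$ be a real Banach space and let $S\subset X$ be a closed set which is epi-Lipschitzian at $\bar{x}\in\mathrm{bdry}\,S$, where $\mathrm{bdry}\,S$ is the boundary of $S$. Then $S$ is strictly Hadamard differentiable at $\bar{x}$ if and only if the Clarke tangent cone $T(\mathrm{bdry}\,S,\bar{x})$ to $\mathrm{bdry}\,S$ at $\bar{x}$ is a closed hyperplane.
   Context: $B(x,r)$ denotes the ball of centre $x$ and radius $r$. Hyperplane: a closed hyperplane of $X$ is a closed linear subspace of codimension $1$. Clarke tangent cone: for $A\subset X$ and $a\in A$, $T(A,a)$ is the set of all $v\in X$ such that for every sequence $(x_n)$ in $A$ converging to $a$ and every sequence $(t_n)$ of positive reals converging to $0$ there is a sequence $(v_n)$ in $X$ converging to $v$ with $x_n+t_nv_n\in A$ for all sufficiently large $n$. Epi-Lipschitzian: $S$ is epi-Lipschitzian at $\bar{x}\in S$ if there exist $\bar{v}\in X\setminus\{0\}$ and $\gamma>0$ such that $S\cap B(\bar{x},\gamma)+tB(\bar{v},\gamma)\subset S$ for all $t\in\,]0,\gamma[$. Local representation: if the closed set $S$ is epi-Lipschitzian at $\bar{x}\in\mathrm{bdry}\,S$, there exist $\bar{v}\in X\setminus\{0\}$, a closed hyperplane $E$ with $X=E\oplus\mathbb{R}\bar{v}$, a neighbourhood $\Omega$ of $\bar{x}$ and a function $f:E\to\mathbb{R}$ that is locally Lipschitzian near $\pi_E(\bar{x})$ such that $\Omega\cap S=\Omega\cap\{u+r\bar{v}: u\in E,\ r\in\mathbb{R},\ f(u)\le r\}$,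 where $\pi_E$ is the projection onto $E$ along $\mathbb{R}\bar{v}$. Such an $f$ is called a local representation of $S$ near $\bar{x}$. Strict Hadamard differentiability of a mapping: a mapping $g:X\to Y$ between normed spaces is strictly Hadamard differentiable at $\bar{x}$ if there is a continuous linear map $Dg(\bar{x}):X\to Y$ such that, for every $h\in X$, $\frac{g(x+tu)-g(x)}{t}\to Dg(\bar{x})(h)$ as $t\to0^+$, $x\to\bar{x}$, $u\to h$. Strict Hadamard differentiability of a set: fix any local representation $f$ of $S$ near $\bar{x}$, that is, fix $\bar{v}\in X\setminus\{0\}$, a closed hyperplane $E$ with $X=E\oplus\mathbb{R}\bar{v}$, a neighbourhood $\Omega$ of $\bar{x}$ and a function $f:E\to\mathbb{R}$ locally Lipschitzian near $\pi_E(\bar{x})$ such that $\Omega\cap S=\Omega\cap\{u+r\bar{v}: u\in E,\ r\in\mathbb{R},\ f(u)\le r\}$, where $\pi_E$ is the projection onto $E$ along $\mathbb{R}\bar{v}$; $S$ (epi-Lipschitzian at $\bar{x}$) is called strictly Hadamard differentiable at $\bar{x}$ if $f$ is strictly Hadamard differentiable at $\pi_E(\bar{x})$. *)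

(* Defs.v *)
From HB Require Import structures.
From mathcomp Require Import all_boot all_order all_algebra.
From mathcomp Require Import all_classical all_reals all_analysis.
From mathcomp Require Import ring lra.

Set Implicit Arguments.
Unset Strict Implicit.
Unset Printing Implicit Defensive.

Import Order.TTheory GRing.Theory Num.Theory.
Import numFieldNormedType.Exports.

Local Open Scope classical_set_scope.
Local Open Scope ring_scope.

Definition bdry (T : topologicalType) (A : set T) : set T :=
  closure A `\` interior A.

(* X = E (+) R v, for a vector v <> 0 *)
Definition line_complement (R : realType) (X : normedModType R)
    (E : set X) (v : X) : Prop :=
  v != 0 /\ forall x, exists! p : X * R, E p.1 /\ x = p.1 + p.2 *: v.

Definition closed_hyperplane (R : realType) (X : normedModType R)
    (E : set X) : Prop :=
  [/\ submod_closed (mem E), closed E & exists v, line_complement E v].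

Definition clarke_tangent_cone (R : realType) (X : normedModType R)
    (A : set X) (a : X) : set X :=
  [set v | forall (x : nat -> X) (t : nat -> R),
     (forall n, A (x n)) -> x @ \oo --> a ->
     (forall n, 0 < t n) -> t @ \oo --> 0 ->
     exists2 w : nat -> X, w @ \oo --> v &
       \forall n \near \oo, A (x n + t n *: w n)].

Definition epi_lipschitzian (R : realType) (X : normedModType R)
    (S : set X) (xbar : X) : Prop :=
  exists v : X, exists gamma : R, [/\ v != 0, 0 < gamma &
    forall t x w, 0 < t < gamma -> (S `&` ball xbar gamma) x ->
      ball v gamma w -> S (x + t *: w)].

Definition strictly_hadamard_differentiable (R : realType)
    (X Y : normedModType R) (g : X -> Y) (xbar : X) : Prop :=
  exists2 Dg : {linear X -> Y}, continuous Dg &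
    forall h : X,
      (fun p : R * X * X =>
         let: (t, x, u) := p in t^-1 *: (g (x + t *: u) - g x))
        @ filter_prod (filter_prod 0^'+ (nbhs xbar)) (nbhs h) --> Dg h.

Definition locally_lipschitz_near (R : realType) (X Y : normedModType R)
    (g : X -> Y) (z : X) : Prop :=
  exists2 U : set X, nbhs z U & [lipschitz g x | x in U].

Record hyperplane (R : realType) (X : normedModType R) := Hyperplane {
  hyperplane_set : set X;
  hyperplane_closed : closed_hyperplane hyperplane_set }.

(* A closed hyperplane as a normed space, with the norm induced by X. *)
Section hyperplane_type.
Context (R : realType) (X : normedModType R) (E : hyperplane X).

Definition hyperplane_pred : {pred X} := mem (hyperplane_set E).

Record hyperplane_type := HyperplaneElt {
  hyperplane_val : X;
  hyperplane_valP : hyperplane_val \in hyperplane_pred }.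

HB.instance Definition _ := [isSub for hyperplane_val].
HB.instance Definition _ := [Choice of hyperplane_type by <:].

Lemma hyperplane_submod_closed : submod_closed hyperplane_pred.
Proof. by case: (hyperplane_closed E). Qed.

HB.instance Definition _ :=
  GRing.isSubmodClosed.Build R X hyperplane_pred hyperplane_submod_closed.
HB.instance Definition _ := [SubChoice_isSubLmodule of hyperplane_type by <:].

Let norm (u : hyperplane_type) : R := `|hyperplane_val u|.

Let normD (u w : hyperplane_type) : norm (u + w) <= norm u + norm w.
Proof. exact: ler_normD. Qed.

Let normZ (r : R) (u : hyperplane_type) : norm (r *: u) = `|r| * norm u.
Proof. exact: normrZ. Qed.

Let norm0_eq0 (u : hyperplane_type) : norm u = 0 -> u = 0.
Proof. by move=> /eqP; rewrite normr_eq0 => /eqP u0; apply: val_inj. Qed.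

HB.instance Definition _ :=
  Lmodule_isNormed.Build R hyperplane_type normD normZ norm0_eq0.

(* The projection onto E along R v. *)
Definition hyperplane_proj (v x : X) : hyperplane_type :=
  xget 0 [set u | exists r : R, x = val u + r *: v].

End hyperplane_type.

Coercion hyperplane_type : hyperplane >-> Sortclass.

Record local_representation (R : realType) (X : normedModType R)
    (S : set X) (xbar : X) := LocalRepresentation {
  lr_dir : X;
  lr_hyperplane : hyperplane X;
  lr_nbhd : set X;
  lr_fun : lr_hyperplane -> R^o;
  lr_complement : line_complement (hyperplane_set lr_hyperplane) lr_dir;
  lr_nbhdP : nbhs xbar lr_nbhd;
  lr_lipschitz :
    locally_lipschitz_near lr_fun (hyperplane_proj lr_hyperplane lr_dir xbar);
  lr_epigraph : lr_nbhd `&` S =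
    lr_nbhd `&` [set x | exists (u : lr_hyperplane) (r : R),
                           x = val u + r *: lr_dir /\ lr_fun u <= r] }.

(* The property of S is read off a local representation rho fixed beforehand;
   local_representation_exists below shows that there always is one. *)
Definition strictly_hadamard_differentiable_set (R : realType)
    (X : normedModType R) (S : set X) (xbar : X)
    (rho : local_representation S xbar) : Prop :=
  strictly_hadamard_differentiable (@lr_fun _ _ _ _ rho)
    (hyperplane_proj (lr_hyperplane rho) (lr_dir rho) xbar).

(* Hahn-Banach: a nonzero vector has a closed complementary hyperplane. *)
Lemma line_complement_gap (R : realType) (X : normedModType R) (v : X) :
  v != 0 -> exists E : set X,
    [/\ closed_hyperplane E, line_complement E v &
        forall (r : R) w, E w -> `|r| * `|v| <= `|r *: v + w|].
Proof.
move=> v0; have N0 : 0 < `|v| by rewrite normr_gt0.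
pose lin (A : set X) := forall (a : R) x y, A x -> A y -> A (a *: x + y).
pose P (A : set X) := lin A /\ forall w, A w -> `|v| <= `|v - w|.
have [F FP Ftot|A [[Alin Agap] Amax]] := @Zorn_bigcup X P.
  split=> [a x y [B FB Bx] [C FC Cy]|w [B /FP[_ +]]]; last exact.
  have [BC|CB] := Ftot _ _ FB FC.
    by exists C => //; apply: (FP _ FC).1 => //; exact: BC.
  by exists B => //; apply: (FP _ FB).1 => //; exact: CB.
have A0 : A 0.
  apply: contrapT => nA0.
  have An x : ~ A x.
    by move=> Ax; apply: nA0; have := Alin (-1) _ _ Ax Ax; rewrite scaleN1r addNr.
  apply: (Amax [set 0]).
    by split=> [x /An //|/(_ 0 erefl)].
  by split=> [a x y /= -> ->|w /= ->]; rewrite ?scaler0 ?addr0 ?subr0.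
have AZ a x : A x -> A (a *: x) by move=> Ax; rewrite -[_ *: _]addr0; exact: Alin.
have AB x y : A x -> A y -> A (y - x).
  by move=> Ax Ay; rewrite addrC -scaleN1r; exact: Alin.
have gap1 c w : A w -> c * `|v| <= `|c *: v + w|.
  move=> Aw; have [c0|c0] := ltP 0 c; last first.
    by apply: le_trans (normr_ge0 _); rewrite mulr_le0_ge0.
  have := Agap _ (AZ (- c^-1) _ Aw).
  rewrite -(ler_pM2l c0) -[X in X * `|_ - _|]gtr0_norm// -normrZ.
  by rewrite scalerBr scaleNr scalerN opprK scalerA divff ?gt_eqF// scale1r.
have gap c w : A w -> `|c| * `|v| <= `|c *: v + w|.
  move=> Aw; case: (ger0P c) => c0; first exact: gap1.
  rewrite -[leRHS]normrN opprD -scaleNr gap1//.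
  by rewrite -scaleN1r; exact: AZ.
have ex x : exists r, A (x - r *: v).
  apply: contrapT => /forallNP nAx.
  pose T := [set z : R | exists r w, A w /\ z = r * `|v| - `|r *: v - x - w|].
  have le_up r w r' w' : A w -> A w' ->
      r * `|v| - `|r *: v - x - w| <= `|r' *: v + x + w'| - r' * `|v|.
    move=> Aw Aw'; rewrite lerBlDr addrAC lerBrDr -mulrDl.
    apply: le_trans (gap1 (r + r') _ (AB _ _ Aw Aw')) _.
    apply: le_trans (ler_normD _ _).
    rewrite [leRHS](_ : _ = `|(r + r') *: v + (w' - w)|)//; congr `|_|.
    rewrite [LHS]addrACA [X in X + _ = _]addrACA subrr addr0.
    by rewrite scalerDl [r *: v + _]addrC.
  have Tsup : has_sup T.
    split; first by exists (0 * `|v| - `|0 *: v - x - 0|), 0, 0.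
    exists (`|0 *: v + x + 0| - 0 * `|v|) => _ [r [w [Aw ->]]].
    exact: le_up.
  pose a := sup T; pose a0 := a / `|v|.
  have lo r w : A w -> r * `|v| - `|r *: v - x - w| <= a.
    by move=> Aw; apply: sup_upper_bound => //; exists r, w.
  have up r w : A w -> a <= `|r *: v + x + w| - r * `|v|.
    move=> Aw; apply: ge_sup; first exact: Tsup.1.
    by move=> _ [r' [w' [Aw' ->]]]; exact: le_up.
  pose B := [set y | exists (s : R) w, A w /\ y = s *: (x - a0 *: v) + w].
  apply: (Amax B).
    split=> [y Ay|BA]; first by exists 0, y; rewrite scale0r add0r.
    by apply: (nAx a0); apply: BA; exists 1, 0; rewrite scale1r addr0.
  split=> [c _ _ [s [w [Aw ->]]] [s' [w' [Aw' ->]]]|_ [s [w [Aw ->]]]].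
    exists (c * s + s'), (c *: w + w'); split; first exact: Alin.
    by rewrite scalerDr scalerA scalerDl addrACA.
  have [s0|s0|->] := ltgtP s 0; last by rewrite scale0r add0r Agap.
  - have Ns0 : 0 < - s by rewrite oppr_gt0.
    have := up ((1 + s * a0) / - s) _ (AZ (s^-1) _ Aw).
    rewrite lerBrDr -(ler_pM2l Ns0) -[X in X * `|_ + _|]gtr0_norm// -normrZ.
    rewrite mulrDr mulrA (mulrC (- s) (_ / _)) divfK ?gt_eqF//.
    rewrite mulrDl mul1r -mulrA divfK ?gt_eqF// mulNr addrCA addNr addr0.
    move/le_trans; apply; rewrite le_eqVlt; apply/orP; left; apply/eqP.
    congr `|_|; rewrite !scalerDr !scalerA (mulrC (- s) (_ / _)).
    rewrite divfK ?gt_eqF// mulNr divff ?lt_eqF// scaleN1r scaleNr.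
    rewrite scalerN scalerA !opprD opprK scalerDl scale1r -!addrA.
    by congr (_ + _); rewrite addrCA.
  - have := lo ((1 + s * a0) / s) _ (AZ (s^-1) _ Aw).
    rewrite lerBlDr -lerBlDl -(ler_pM2l s0).
    rewrite -[X in X * `|_ - _ - _|]gtr0_norm// -normrZ.
    rewrite mulrBr mulrA (mulrC s (_ / _)) divfK ?gt_eqF//.
    rewrite mulrDl mul1r -mulrA divfK ?gt_eqF// addrK.
    move/le_trans; apply; rewrite le_eqVlt; apply/orP; left; apply/eqP.
    congr `|_|; rewrite !scalerBr !scalerA (mulrC s (_ / _)).
    rewrite divfK ?gt_eqF// divff ?gt_eqF// scale1r.
    rewrite !opprD opprK scalerDl scale1r -!addrA.
    by congr (_ + _); rewrite addrCA.
have Av : line_complement A v.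
  split=> // x; have [r Ar] := ex x; exists (x - r *: v, r).
  split=> [|[w s] /= [Aw xws]]; first by rewrite subrK.
  have : `|s - r| * `|v| <= 0.
    apply: le_trans (gap _ _ (AB _ _ Ar Aw)) _.
    have -> : w = x - s *: v by rewrite xws addrK.
    rewrite opprB [x - s *: v + _]addrC [r *: v - x + _]addrA subrK.
    by rewrite scalerBl addrA subrK subrr normr0.
  rewrite pmulr_lle0// normr_le0 subr_eq0 => /eqP sr.
  by rewrite xws sr addrK.
exists A; split=> //; split; last by exists v.
  by split=> [|a x y]; rewrite !inE//; exact: Alin.
move=> x clx; have [r Ar] := ex x.
have [r0|r0] := eqVneq r 0; first by move: Ar; rewrite r0 scale0r subr0.
have e0 : 0 < `|r| * `|v| by rewrite mulr_gt0 ?normr_gt0.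
have [y [Ay]] := clx _ (nbhsx_ballx x _ e0).
rewrite -ball_normE/= ltNge => /negP[].
by apply: le_trans (gap r _ (AB _ _ Ay Ar)) _; rewrite addrA (addrC x) addrA subrr add0r.
Qed.

Lemma local_representation_exists (R : realType) (X : normedModType R)
    (S : set X) (xbar : X) :
  closed S -> bdry S xbar -> epi_lipschitzian S xbar ->
  inhabited (local_representation S xbar).
Proof.
move=> clS [clSx nintS] [v [g [v0 g0 epi]]].
have [E [hE Ev gap]] := line_complement_gap v0.
have N0 : 0 < `|v| by rewrite normr_gt0.
pose H := Hyperplane hE.
have HP (u : H) : E (val u) by have := valP u; rewrite inE.
have dec x : exists (u : H) (r : R), x = val u + r *: v.
  have [[w r] [/= [Ew ->] _]] := Ev.2 x.
  by exists (HyperplaneElt (mem_set Ew : w \in hyperplane_pred H)), r.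
have normH (u : H) : `|u| = `|val u| by [].
have [u0 [r0 xE]] := dec xbar.
have gapH (u w : H) (r : R) : `|r| * `|v| <= `|val u + r *: v - val w|.
  rewrite addrAC addrC -(raddfB (val : H -> X)); by apply: gap; exact: HP.
have projE : hyperplane_proj H v xbar = u0.
  rewrite /hyperplane_proj; apply: xget_unique; first by exists r0.
  move=> u [r ur]; apply/val_inj/esym.
  move: ur; rewrite xE => /eqP; rewrite -subr_eq => /eqP ur.
  have := gapH u0 u (r0 - r).
  rewrite scalerBl addrA ur subrr normr0 pmulr_lle0// normr_le0 subr_eq0 => /eqP r0r.
  by rewrite -ur r0r addrK.
pose eta := g / (3 * (1 + `|v|)).
have etaE : 3 * eta + 3 * (eta * `|v|) = g.
  by rewrite /eta; field; rewrite gt_eqF// addr_gt0.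
have eta0 : 0 < eta by rewrite divr_gt0// mulr_gt0// addr_gt0.
have etaN0 : 0 < eta * `|v| by rewrite mulr_gt0.
pose rho := Num.min (g / 2) (eta * g / 2).
have rho0 : 0 < rho by rewrite lt_min !divr_gt0 ?mulr_gt0.
have rho_g : rho <= g / 2 by rewrite ge_min lexx.
have rho_e : rho <= eta * g / 2 by rewrite ge_min lexx orbT.
have cyl (u : H) (r : R) : `|u - u0| < rho -> `|r - r0| <= eta ->
    ball xbar g (val u + r *: v).
  move=> uu0 rr0; rewrite -ball_normE/= distrC xE opprD addrACA -scalerBl.
  apply: le_lt_trans (ler_normD _ _) _; rewrite normrZ.
  have := ler_wpM2r (ltW N0) rr0.
  rewrite normH raddfB in uu0; lra.
have up (y : X) (z : X) (t : R) : S y -> ball xbar g y -> 0 < t < g ->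
    `|z - y - t *: v| < g * t -> S z.
  move=> Sy By /[dup] tg /andP[t0 _] zy.
  have := epi t y (t^-1 *: (z - y)) tg (conj Sy By).
  rewrite scalerA divff ?gt_eqF// scale1r [y + _]addrC subrK; apply.
  rewrite -ball_normE/= -(ltr_pM2l t0) -[X in X * `|_|]gtr0_norm// -normrZ.
  by rewrite scalerBr scalerA divff ?gt_eqF// scale1r distrC [t * g]mulrC.
have xbarS : S xbar by exact: clS.
pose T (u : H) := [set r : R | `|r - r0| <= eta /\ S (val u + r *: v)].
pose f (u : H) : R^o := inf (T u).
have Tlb (u : H) : has_lbound (T u).
  by exists (r0 - eta) => r [+ _]; rewrite ler_distl => /andP[].
have Ttop (u : H) : `|u - u0| < rho -> T u (r0 + eta).
  move=> uu0; split; first by rewrite addrC addKr gtr0_norm.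
  apply: (up xbar _ eta) => //; first exact: ballxx.
    by rewrite eta0/=; lra.
  rewrite xE scalerDl opprD addrACA [r0 *: v + _]addrC addrK.
  rewrite addrK.
  rewrite normH raddfB in uu0; apply: lt_le_trans uu0 _.
  by apply: le_trans rho_e _; have := mulr_gt0 eta0 g0; lra.
have eta_g : 2 * eta < g by lra.
have Tinf (u : H) : `|u - u0| < rho -> has_inf (T u).
  by move=> /Ttop Tu; split => //; exists (r0 + eta).
have fP (u : H) (r : R) : `|u - u0| < rho -> `|r - r0| <= eta ->
    S (val u + r *: v) <-> f u <= r.
  move=> uu0 rr0; split=> [Sr|fr]; first exact: ge_inf.
  have below r1 : T u r1 -> r1 <= r -> S (val u + r *: v).
    move=> [r1r0 Sr1]; rewrite le_eqVlt => /predU1P[<-//|r1r].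
    apply: (up (val u + r1 *: v) _ (r - r1)) => //; first exact: cyl.
      rewrite subr_gt0 r1r/=; apply: le_lt_trans eta_g.
      by move: r1r0 rr0; rewrite !ler_distl => /andP[? ?] /andP[? ?]; lra.
    rewrite opprD addrACA subrr add0r -!scalerBl subrr scale0r normr0.
    by rewrite mulr_gt0// subr_gt0.
  apply: clS => B /nbhs_ballP[e /= e0 eB].
  have [r1 Tr1 r1f] := inf_adherent (divr_gt0 e0 N0) (Tinf u uu0).
  have [r1r|rr1] := leP r1 r.
    exists (val u + r *: v); split; first exact: below r1r.
    by apply: eB; exact: ballxx.
  exists (val u + r1 *: v); split; first exact: Tr1.2.
  apply: eB; rewrite -ball_normE/= opprD addrACA subrr add0r -scalerBl normrZ.
  rewrite distrC gtr0_norm ?subr_gt0// -ltr_pdivlMr//.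
  by rewrite ltrBlDl; apply: lt_le_trans r1f _; rewrite lerD2r.
have fr0 (u : H) : `|u - u0| < rho -> `|f u - r0| <= eta.
  move=> uu0; rewrite ler_distl; apply/andP; split.
    apply: lb_le_inf; first exact: (Tinf u uu0).1.
    by move=> r [+ _]; rewrite ler_distl => /andP[].
  by apply: ge_inf => //; exact: Ttop.
have flip (u w : H) : `|u - u0| < rho -> `|w - u0| < rho ->
    f w - f u <= 2 / g * `|u - w|.
  move=> uu0 wu0; rewrite lerBlDl.
  have [->|uw] := eqVneq u w; first by rewrite subrr normr0 mulr0 addr0.
  have uw0 : 0 < `|u - w| by rewrite normr_gt0 subr_eq0.
  set t := 2 / g * `|u - w|.
  have tE : g * t = 2 * `|u - w| by rewrite /t; field; rewrite gt_eqF.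
  have t0 : 0 < t by rewrite mulr_gt0// divr_gt0.
  have uw_rho : `|u - w| < rho + rho.
    by apply: le_lt_trans (ler_distD u0 _ _) _; rewrite [`|u0 - w|]distrC ltrD.
  have tg : t < g.
    rewrite -(ltr_pM2l g0) tE.
    have : g * (2 * eta) < g * g by rewrite ltr_pM2l.
    lra.
  have [le_top|/ltW top_le] := leP (f u + t) (r0 + eta); last first.
    by apply: le_trans top_le; apply: ge_inf => //; exact: Ttop.
  apply: ge_inf => //; split.
    have := fr0 u uu0; rewrite !ler_distl => /andP[? ?]; apply/andP; split=> //.
    lra.
  apply: (up (val u + f u *: v) _ t); last 1 first.
  - rewrite scalerDl opprD addrACA [_ *: v + _]addrC addrK addrK tE.
    by rewrite distrC -(raddfB (val : H -> X)) -normH; lra.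
  - by apply/(fP u (f u) uu0 (fr0 u uu0)).
  - by apply: cyl => //; exact: fr0.
  - by rewrite t0.
pose e := Num.min (rho / 2) (eta * `|v|).
have e0 : 0 < e by rewrite lt_min divr_gt0.
have Om (u : H) (r : R) : ball xbar e (val u + r *: v) ->
    `|u - u0| < rho /\ `|r - r0| <= eta.
  rewrite -ball_normE/= lt_min => /andP[b1 b2].
  have dE : xbar - (val u + r *: v) = val u0 + (r0 - r) *: v - val u.
    by rewrite xE scalerBl addrA opprD [- val u + _]addrC addrA.
  have := gapH u0 u (r0 - r); rewrite -dE => rr0; split; last first.
    by rewrite distrC -(ler_pM2r N0); apply: le_trans rr0 (ltW b2).
  rewrite distrC normH raddfB/=.
  have -> : val u0 - val u = xbar - (val u + r *: v) - (r0 - r) *: v.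
    by rewrite dE addrAC addrK.
  apply: le_lt_trans (ler_normB _ _) _; rewrite normrZ; lra.
split; apply: (@LocalRepresentation R X S xbar v H (ball xbar e) f Ev).
- exact: nbhsx_ballx.
- rewrite projE; exists (ball u0 rho); first exact: nbhsx_ballx.
  apply: (@klipschitzW _ _ _ (2 / g)).
    by apply: (@globally_properfilter _ _ (u0, u0)); split; exact: ballxx.
  move=> [u w] [/=]; rewrite -!ball_normE/= => uu0 wu0.
  rewrite distrC in uu0; rewrite distrC in wu0.
  rewrite ler_norml lerNl opprB [X in _ && X](_ : _ = true) ?andbT.
    exact: flip.
  by rewrite distrC; exact: flip.
- apply/seteqP; split=> x [Bx].
    move=> Sx; split=> //; have [u [r xur]] := dec x.
    rewrite xur in Bx Sx; have [uu0 rr0] := Om _ _ Bx.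
    by exists u, r; split=> //; apply/(fP u r).
  move=> [u [r [xur fr]]]; split=> //.
  rewrite xur in Bx *; have [uu0 rr0] := Om _ _ Bx.
  by apply/(fP u r).
Qed.

(* Main.v *)
(* Near xbar, bdry S is the graph of the locally Lipschitz function f, so
   T(bdry S, xbar) is the graph of h |-> Df(h) over the set of directions h in
   which the strict directional derivative Df(h) exists. If f is strictly
   Hadamard differentiable this is the graph of a continuous linear functional
   on E. Conversely, a graph that is a linear subspace of codimension one is
   defined on all of E, so Df is linear everywhere; the Lipschitz bound on f
   makes Df continuous and the limit uniform under perturbation of h. *)

Require Import Defs.
From HB Require Import structures.
From mathcomp Require Import all_boot all_order all_algebra.
From mathcomp Require Import all_classical all_reals all_analysis.
From mathcomp Require Import ring lra.

Set Implicit Arguments.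
Unset Strict Implicit.
Unset Printing Implicit Defensive.

Import Order.TTheory GRing.Theory Num.Theory.
Import numFieldNormedType.Exports.

Local Open Scope classical_set_scope.
Local Open Scope ring_scope.

(** * Strict directional derivatives of locally Lipschitz functions *)

(* The direction h is kept fixed: for locally Lipschitz g this loses nothing
   against letting it vary, see strictly_hadamard_dderivative. *)
Definition strict_dderivative (R : realType) (X : normedModType R)
    (g : X -> R) (a h : X) (l : R) : Prop :=
  forall e : R, 0 < e -> exists2 d : R, 0 < d &
    forall (t : R) x, 0 < t < d -> `|x - a| < d ->
      `|g (x + t *: h) - g x - t * l| <= e * t.

Lemma locally_lipschitz_ball (R : realType) (X : normedModType R)
    (g : X -> R) (a : X) : locally_lipschitz_near (g : X -> R^o) a ->
  exists M d : R, [/\ 0 < M, 0 < d & forall x y,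
    `|x - a| < d -> `|y - a| < d -> `|g x - g y| <= M * `|x - y|].
Proof.
move=> [U /nbhs_ballP[d /= d0 dU] [M [_ lipM]]].
(* The Lipschitz hypothesis holds for every constant strictly above [M]; this choice lies above [M]
   and is positive as well. *)
exists (Num.max M 0 + 1), d; split=> // [|x y xa ya].
  by rewrite ltr_wpDl// le_max lexx orbT.
apply: (lipM _ _ (x, y)) => //=.
  by rewrite (@le_lt_trans _ _ (Num.max M 0))// ?le_max ?lexx// ltrDl.
by split; apply: dU; rewrite -ball_normE/= distrC.
Qed.

(** The radius [c] solves [c + c * (|k| + 1) = d]. The slack [1] in the bound on [h] admits every
    direction within distance 1 of [k], as needed when directions vary. *)
Lemma add_scale_near (R : realType) (X : normedModType R) (k : X) (d : R) :
  0 < d -> exists2 c : R, 0 < c & forall (t : R) (x a h : X),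
    0 < t < c -> `|x - a| < c -> `|h| <= `|k| + 1 -> `|x + t *: h - a| < d.
Proof.
move=> d0; have k0 : 0 < 1 + (`|k| + 1) by rewrite !ltr_wpDl.
exists (d / (1 + (`|k| + 1))) => [|t x a h /andP[t0 tc] xa hk].
  by rewrite divr_gt0.
rewrite addrAC; apply: le_lt_trans (ler_normD _ _) _.
rewrite normrZ gtr0_norm//.
have := ler_wpM2l (ltW t0) hk.
have : t * (`|k| + 1) <= d / (1 + (`|k| + 1)) * (`|k| + 1).
  by rewrite ler_wpM2r ?ltW// ltr_wpDl.
have : d / (1 + (`|k| + 1)) + d / (1 + (`|k| + 1)) * (`|k| + 1) = d.
  by field; rewrite gt_eqF.
lra.
Qed.

(** At the base point [a] and for one small [t], the increments of [g] in the directions [h] and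
    [h'] differ by at most [M * t * |h - h'|]; dividing by [t] gives the bound. Both uniqueness and
    continuity of the derivative come from it. *)
Lemma strict_dderivative_norm (R : realType) (X : normedModType R)
    (g : X -> R) (a : X) : locally_lipschitz_near (g : X -> R^o) a ->
  exists2 M : R, 0 < M & forall h h' l l',
    strict_dderivative g a h l -> strict_dderivative g a h' l' ->
    `|l - l'| <= M * `|h - h'|.
Proof.
move=> /locally_lipschitz_ball[M [d [M0 d0 lip]]].
exists M => // h h' l l' gl gl'; apply/ler_addgt0Pr => e e0.
have e20 : 0 < e / 2 by rewrite divr_gt0.
have [d1 d10 gd1] := gl _ e20; have [d2 d20 gd2] := gl' _ e20.
have [c c0 cP] := add_scale_near h d0; have [c' c'0 c'P] := add_scale_near h' d0.
have m0 : 0 < Num.min (Num.min d1 d2) (Num.min c c').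
  by rewrite !lt_min d10 d20 c0 c'0.
set m := Num.min _ _ in m0.
pose t := m / 2; have t0 : 0 < t by rewrite divr_gt0.
have : t < m by rewrite /t ltr_pdivrMr// ltr_pMr// ltr1n.
rewrite !lt_min -!andbA => /and4P[td1 td2 tc tc'].
have := gd1 t a; rewrite t0 td1 subrr normr0 => /(_ isT d10) A1.
have := gd2 t a; rewrite t0 td2 subrr normr0 => /(_ isT d20) A2.
have A3 : `|g (a + t *: h) - g (a + t *: h')| <= M * (t * `|h - h'|).
  apply: le_trans (lip _ _ _ _) _.
  - by apply: cP; rewrite ?t0 ?subrr ?normr0// lerDl.
  - by apply: c'P; rewrite ?t0 ?subrr ?normr0// lerDl.
  by rewrite opprD addrACA subrr add0r -scalerBr normrZ gtr0_norm.
rewrite -(ler_pM2l t0) -[X in X * `|_|]gtr0_norm// -normrM.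
move: A1 A2 A3; rewrite !ler_norml => /andP[? ?] /andP[? ?] /andP[? ?].
by apply/andP; split; lra.
Qed.

Lemma strict_dderivative_unique (R : realType) (X : normedModType R)
    (g : X -> R) (a h : X) (l l' : R) :
  locally_lipschitz_near (g : X -> R^o) a ->
  strict_dderivative g a h l -> strict_dderivative g a h l' -> l = l'.
Proof.
move=> /strict_dderivative_norm[M _ gM] gl gl'; apply/eqP.
by have := gM _ _ _ _ gl gl'; rewrite subrr normr0 mulr0 normr_le0 subr_eq0.
Qed.

Lemma strict_dderivative0 (R : realType) (X : normedModType R)
    (g : X -> R) (a : X) : strict_dderivative g a 0 0.
Proof.
move=> e e0; exists 1 => // t x /andP[t0 _] _.
by rewrite scaler0 addr0 mulr0 subr0 subrr normr0 mulr_ge0 ?ltW.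
Qed.

Lemma ler_dist_quotient (R : realFieldType) (p l e t : R) : 0 < t ->
  (`|l - t^-1 * p| <= e) = (`|p - t * l| <= e * t).
Proof.
move=> t0; rewrite -(ler_pM2r t0) -[X in _ * X <= _]gtr0_norm// -normrM distrC.
by rewrite mulrBl mulrAC mulVf ?gt_eqF// mul1r [l * t]mulrC.
Qed.

(** From left to right, take the constant direction [u = h]. From right to left, replacing [u] by
    [h] changes the increment by at most [M * t * |u - h|], which is absorbed by taking [u] close to
    [h]. *)
Lemma strictly_hadamard_dderivative (R : realType) (X : normedModType R)
    (g : X -> R) (a : X) : locally_lipschitz_near (g : X -> R^o) a ->
  strictly_hadamard_differentiable (g : X -> R^o) a <->
  exists2 D : {linear X -> R^o}, continuous D &
    forall h, strict_dderivative g a h (D h).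
Proof.
move=> lipg; split=> -[D cD Dg]; exists D => // h.
  move=> e e0.
  have /cvgrPdist_le/(_ e e0)[[/= P Q] [[[/= P1 P2]]]] := Dg h.
  move=> [/nbhs_ballP[d1 /= d10 dP1] /nbhs_ballP[d2 /= d20 dP2]] P12 Qh PQ.
  exists (Num.min d1 d2) => [|t x /andP[t0]]; first by rewrite lt_min d10.
  rewrite !lt_min => /andP[td1 _] /andP[_ xd2].
  have /= := PQ (t, x, h); rewrite (_ : (_ /\ _) = True); last first.
    apply/propext; split=> // _; split; last exact: nbhs_singleton.
    apply: P12; split=> /=.
      by apply: dP1 => //; rewrite -ball_normE/= sub0r normrN gtr0_norm.
    by apply: dP2; rewrite -ball_normE/= distrC.
  by move=> /(_ I); rewrite (ler_dist_quotient _ _ _ t0).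
apply/cvgrPdist_le => e e0.
have [M [d [M0 d0 lip]]] := locally_lipschitz_ball lipg.
have e20 : 0 < e / 2 by rewrite divr_gt0.
have [d1 d10 gd1] := Dg h _ e20; have [c c0 cP] := add_scale_near h d0.
pose b := Num.min d1 c; have b0 : 0 < b by rewrite lt_min d10.
(* The bound [1] keeps [u] within reach of [add_scale_near]; [e / 2 / M] makes the cost of replacing
   [u] by [h] at most [t * (e / 2)]. *)
pose r := Num.min 1 (e / 2 / M).
have r0 : 0 < r by rewrite lt_min ltr01 divr_gt0.
exists ([set t : R | 0 < t < b] `*` ball a b, ball h r) => /=.
  split; last exact: nbhsx_ballx.
  exists ([set t : R | 0 < t < b], ball a b) => //=; split; last exact: nbhsx_ballx.
  by near=> t => /=; apply/andP; split; near: t; [exact: nbhs_right_gt|exact: nbhs_right_lt].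
move=> [[t x] u] /= [[/andP[t0 tb]]].
rewrite -!ball_normE/= ![`|_ - x|]distrC [`|_ - u|]distrC => xb ur.
move: (tb) (xb) (ur); rewrite !lt_min => /andP[td1 tc] /andP[xd1 xc] /andP[u1 ue].
have uh : `|u| <= `|h| + 1.
  by rewrite -(subrK h u) addrC; apply: le_trans (ler_normD _ _) _; rewrite lerD2l ltW.
have A1 := gd1 t x; rewrite t0 td1 in A1; have {}A1 := A1 isT xd1.
have A2 : `|g (x + t *: u) - g (x + t *: h)| <= t * (e / 2).
  apply: le_trans (lip _ _ _ _) _.
  - by apply: cP; rewrite ?t0.
  - by apply: cP; rewrite ?t0// lerDl.
  rewrite opprD addrACA subrr add0r -scalerBr normrZ gtr0_norm//.
  by rewrite mulrCA ler_pM2l// mulrC -ler_pdivlMr// ltW.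
rewrite (ler_dist_quotient _ _ _ t0).
move: A1 A2; rewrite !ler_norml => /andP[? ?] /andP[? ?].
by apply/andP; split; lra.
Unshelve. all: by end_near.
Qed.

(** * Coordinates along [E] and [v], with norm estimates *)

Lemma hyperplane_decomp (R : realType) (X : normedModType R) (E : hyperplane X)
    (v x : X) : line_complement (hyperplane_set E) v ->
  exists (u : E) (r : R), x = val u + r *: v.
Proof.
move=> [_ /(_ x)[[w r] [/= [Ew ->] _]]].
by exists (HyperplaneElt (mem_set Ew : w \in hyperplane_pred E)), r.
Qed.

Lemma hyperplane_decomp_inj (R : realType) (X : normedModType R)
    (E : hyperplane X) (v : X) (u u' : E) (r r' : R) :
  line_complement (hyperplane_set E) v ->
  val u + r *: v = val u' + r' *: v -> u = u' /\ r = r'.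
Proof.
have EP (w : E) : hyperplane_set E (val w) by have := valP w; rewrite inE.
move=> [_ /(_ (val u + r *: v))[p [_ pU]]] uu'.
have pu := pU (val u, r) (conj (EP u) erefl).
have := pU (val u', r') (conj (EP u') uu').
by rewrite pu => -[/val_inj -> ->].
Qed.

Lemma hyperplane_projE (R : realType) (X : normedModType R) (E : hyperplane X)
    (v : X) (u : E) (r : R) : line_complement (hyperplane_set E) v ->
  hyperplane_proj E v (val u + r *: v) = u.
Proof.
move=> Ev; apply: xget_unique; first by exists r.
by move=> u' [r' /(hyperplane_decomp_inj Ev)[]].
Qed.

(* [E] closed puts [v] at positive distance from [E]. *)
Lemma hyperplane_decomp_norm (R : realType) (X : normedModType R)
    (E : hyperplane X) (v : X) : line_complement (hyperplane_set E) v ->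
  exists2 K : R, 0 < K & forall (u : E) (r : R),
    `|u| <= K * `|val u + r *: v| /\ `|r| <= K * `|val u + r *: v|.
Proof.
move=> Ev; have [_ clE _] := hyperplane_closed E.
have EP (w : E) : hyperplane_set E (val w) by have := valP w; rewrite inE.
have nEv : ~ hyperplane_set E v.
  move=> vE; pose w : E := HyperplaneElt (mem_set vE : v \in hyperplane_pred E).
  have : val w + 0 *: v = val (0 : E) + 1 *: v.
    by rewrite scale0r addr0 scale1r raddf0 add0r.
  by move=> /(hyperplane_decomp_inj Ev)[_ /esym/eqP]; rewrite oner_eq0.
have : nbhs v (~` hyperplane_set E).
  by apply: open_nbhs_nbhs; split=> //; exact: closed_openC.
move=> /nbhs_ballP[e /= e0 eE].
(* Otherwise [- r^-1 *: val u], a point of [E], would lie within [e] of [v]. *)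
have rN (u : E) (r : R) : e * `|r| <= `|val u + r *: v|.
  have [->|r0] := eqVneq r 0; first by rewrite normr0 mulr0.
  rewrite leNgt; apply/negP => lt.
  apply: (eE (- r^-1 *: val u)); last first.
    have -> : - r^-1 *: val u = val (- r^-1 *: u) by rewrite linearZ.
    exact: EP.
  rewrite -ball_normE/= scaleNr opprK.
  rewrite -(ltr_pM2r (_ : 0 < `|r|)) ?normr_gt0// mulrC -normrZ.
  by rewrite scalerDr scalerA divff// scale1r addrC.
exists (1 + `|v| / e + e^-1) => [|u r].
  by rewrite addr_gt0 ?invr_gt0// ltr_pwDl// divr_ge0// ltW.
have re : `|r| <= e^-1 * `|val u + r *: v| by rewrite mulrC ler_pdivlMr// mulrC.
have N0 := normr_ge0 (val u + r *: v).
have u1 : `|u| <= `|val u + r *: v| + `|r| * `|v|.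
  rewrite -[leLHS]/(`|val u|) -{1}(addrK (r *: v) (val u)).
  by apply: le_trans (ler_normB _ _) _; rewrite normrZ.
have vr : `|r| * `|v| <= `|v| / e * `|val u + r *: v|.
  by rewrite mulrC -mulrA ler_wpM2l.
have vN : 0 <= `|v| / e * `|val u + r *: v| by rewrite mulr_ge0// divr_ge0// ltW.
have eN : 0 <= e^-1 * `|val u + r *: v| by rewrite mulr_ge0// invr_ge0 ltW.
by split; lra.
Qed.

(** * The boundary as a graph, and its Clarke tangent cone *)

(** Where [f u < r], continuity of [f] keeps the inequality on a neighbourhood, so the point is
    interior to [S]. Where [f u = r], an arbitrarily small move along [- v] leaves [S]. *)
Lemma local_representation_bdry (R : realType) (X : normedModType R)
    (S : set X) (xbar : X) (rho : local_representation S xbar) :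
  closed S -> exists2 d : R, 0 < d &
    forall (u : lr_hyperplane rho) (r : R), `|val u + r *: lr_dir rho - xbar| < d ->
      bdry S (val u + r *: lr_dir rho) <-> lr_fun u = r.
Proof.
case: rho => v E Om f /= Ev /nbhs_ballP[d1 /= d10 dOm] lipf epi clS.
have [M [d2 [M0 d20 lip]]] := locally_lipschitz_ball lipf.
have [K K0 EK] := hyperplane_decomp_norm Ev.
have [u0 [r0 xE]] := hyperplane_decomp xbar Ev.
rewrite {lipf}xE hyperplane_projE// in lip dOm *.
have near_u (u u' : E) (r r' : R) :
    `|u - u'| <= K * `|val u + r *: v - (val u' + r' *: v)| /\
    `|r - r'| <= K * `|val u + r *: v - (val u' + r' *: v)|.
  have := EK (u - u') (r - r').
  by rewrite raddfB/= scalerBl opprD addrACA.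
(* [d1] keeps the point in [Om]; [d2 / K] keeps its [E]-component in the ball where [f] is
   Lipschitz. *)
pose d := Num.min d1 (d2 / K).
have d0 : 0 < d by rewrite lt_min d10 divr_gt0.
exists d => // u r; rewrite lt_min ltr_pdivlMr// => /andP[ud1 ud2].
have SP (u' : E) (r' : R) : `|val u' + r' *: v - (val u0 + r0 *: v)| < d1 ->
    S (val u' + r' *: v) <-> f u' <= r'.
  move=> ud; have OmP : Om (val u' + r' *: v).
    by apply: dOm; rewrite -ball_normE/= distrC.
  split=> [Su|fr].
    have : (Om `&` S) (val u' + r' *: v) by [].
    by rewrite epi => -[_ [u'' [r'' [/(hyperplane_decomp_inj Ev)[-> ->]]]]].
  have : (Om `&` S) (val u' + r' *: v) by rewrite epi; split=> //; exists u', r'.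
  by case.
have uu0 : `|u - u0| < d2.
  by apply: le_lt_trans (near_u _ _ _ _).1 _; rewrite mulrC; exact: ud2.
split=> [[+ nint]|fr].
  rewrite -(closure_id S).1// => Su; apply/eqP; rewrite eq_le.
  rewrite ((SP _ _ ud1).1 Su)/= leNgt; apply/negP => fr.
  apply: nint; apply/nbhs_normP => /=.
  (* The first two terms keep nearby points where the epigraph and Lipschitz descriptions apply. The
     third preserves [f u' <= r'], since a move of length [N] changes [f u - r] by at most
     [K * (M + 1) * N]. *)
  pose e := Num.min (d1 - `|val u + r *: v - (val u0 + r0 *: v)|)
    (Num.min ((d2 - `|u - u0|) / K) ((r - f u) / (K * (M + 1)))).
  have KM0 : 0 < K * (M + 1) by rewrite mulr_gt0// ltr_wpDl// ltW.
  exists e => /=; first by rewrite !lt_min subr_gt0 ud1 !divr_gt0 ?subr_gt0.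
  move=> y /=; have [u' [r' ->]] := hyperplane_decomp y Ev.
  rewrite !lt_min !ltr_pdivlMr// => /and3P[e1 e2 e3].
  have [n1 n2] := near_u u u' r r'.
  set N := `|val u + r *: v - _| in e1 e2 e3 n1 n2.
  have u'u0 : `|u' - u0| < d2.
    apply: le_lt_trans (ler_distD u _ _) _; rewrite distrC.
    by rewrite -ltrBrDr; apply: le_lt_trans n1 _; rewrite mulrC.
  apply/SP.
    apply: le_lt_trans (ler_distD (val u + r *: v) _ _) _.
    by rewrite distrC -ltrBrDr.
  have := lip _ _ u'u0 uu0.
  have := ler_wpM2l (ltW M0) n1; rewrite [`|u - _|]distrC.
  move: n2; rewrite !ler_norml => /andP[? ?] ? /andP[? ?].
  have : N * (K * (M + 1)) = M * (K * N) + K * N by ring.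
  lra.
split; first by apply: subset_closure; apply/SP => //; rewrite fr.
move=> /nbhs_normP[e /= e0 eS].
have vn0 : 0 < `|v| by rewrite normr_gt0; exact: Ev.1.
(* A descent by [c] along [v] stays both in the ball contained in [S] and in the ball where [S] is
   the epigraph; halving makes the bounds strict. *)
pose c := Num.min (e / `|v|) ((d1 - `|val u + r *: v - (val u0 + r0 *: v)|) / `|v|) / 2.
have c0 : 0 < c by rewrite divr_gt0// lt_min !divr_gt0// subr_gt0.
have : c < Num.min (e / `|v|) ((d1 - `|val u + r *: v - (val u0 + r0 *: v)|) / `|v|).
  by move: c0; rewrite /c; lra.
rewrite lt_min !ltr_pdivlMr// => /andP[ce cd].
have : S (val u + (r - c) *: v).
  apply: eS => /=; rewrite opprD addrACA subrr add0r -scalerBl normrZ.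
  by rewrite opprB addrCA subrr addr0 gtr0_norm.
move/SP; rewrite fr => /(_ _)/wrap[].
  apply: le_lt_trans (ler_distD (val u + r *: v) _ _) _.
  rewrite -ltrBrDr opprD addrACA subrr add0r -scalerBl normrZ.
  by rewrite addrAC subrr add0r normrN gtr0_norm.
by rewrite lerBrDr gerDl leNgt c0.
Qed.

(** A graph point is determined by its [E]-component, so a tangent direction [(h, s)] says that
    difference quotients of [f] at moving base points, in directions tending to [h], tend to [s].
    The Lipschitz bound allows the direction to be frozen at [h]. *)
Lemma clarke_tangent_cone_graph (R : realType) (X : normedModType R)
    (E : hyperplane X) (v : X) (f : E -> R) (A : set X) (u0 : E) (d : R)
    (h : E) (s : R) : line_complement (hyperplane_set E) v ->
  locally_lipschitz_near (f : E -> R^o) u0 -> 0 < d ->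
  (forall (u : E) (r : R),
    `|val u + r *: v - (val u0 + f u0 *: v)| < d ->
    A (val u + r *: v) <-> f u = r) ->
  clarke_tangent_cone A (val u0 + f u0 *: v) (val h + s *: v) <->
  strict_dderivative f u0 h s.
Proof.
move=> Ev lipf d0 AP.
have [M [d2 [M0 d20 lip]]] := locally_lipschitz_ball lipf.
have [K K0 EK] := hyperplane_decomp_norm Ev.
have near_u (u u' : E) (r r' : R) :
    `|u - u'| <= K * `|val u + r *: v - (val u' + r' *: v)| /\
    `|r - r'| <= K * `|val u + r *: v - (val u' + r' *: v)|.
  have := EK (u - u') (r - r').
  by rewrite raddfB/= scalerBl opprD addrACA.
have val_affine (u k : E) (t : R) : val (u + t *: k) = val u + t *: val k.
  by rewrite [_ + _]addrC linearP addrC.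
have [c c0 cP] := add_scale_near h d20.
split=> [Th|fh].
  apply: contrapT => nfh.
  have [e e0 nfe] : exists2 e : R, 0 < e & forall k, 0 < k -> exists (t : R) (u : E),
      [/\ 0 < t < k, `|u - u0| < k & e * t < `|f (u + t *: h) - f u - t * s|].
    apply: contrapT => nex; apply: nfh => e e0; apply: contrapT => nk.
    apply: nex; exists e => // k k0; apply: contrapT => ntu.
    apply: nk; exists k => // t u tk uk; rewrite leNgt; apply/negP => lt.
    by apply: ntu; exists t, u.
  have D0 : 0 < 1 + M * `|v| by rewrite ltr_wpDr// mulr_ge0// ltW.
  (* [n.+1%:R^-1] forces convergence, [d2] and [c] keep all points in the Lipschitz ball, and the
     last term keeps the lift to the graph within [d], by [gdist]. *)
  pose k n := Num.min n.+1%:R^-1 (Num.min (Num.min d2 c) (d / (1 + M * `|v|))).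
  have k0 n : 0 < k n by rewrite !lt_min invr_gt0 ltr0Sn d20 c0 divr_gt0.
  have /choice[t /choice[u tu]] n := nfe _ (k0 n).
  have t0 n : 0 < t n by have [/andP[]] := tu n.
  have klt (b : R) : 0 < b -> \forall n \near \oo, k n < b.
    move=> b0; have := near_infty_natSinv_lt (PosNum b0); apply: filterS => n.
    by apply: le_lt_trans; rewrite ge_min lexx.
  have gdist (w : E) : `|w - u0| < d2 ->
      `|val w + f w *: v - (val u0 + f u0 *: v)| <= (1 + M * `|v|) * `|w - u0|.
    move=> wd; rewrite opprD addrACA -scalerBl; apply: le_trans (ler_normD _ _) _.
    rewrite normrZ mulrDl mul1r -raddfB lerD2l mulrAC ler_wpM2r//.
    by apply: lip; rewrite // subrr normr0.
  have ud2 n : `|u n - u0| < d2.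
    by have [_ + _] := tu n; rewrite !lt_min -!andbA => /and4P[].
  pose x n := val (u n) + f (u n) *: v.
  have xA n : A (x n).
    apply/AP => //; apply: le_lt_trans (gdist _ (ud2 n)) _.
    rewrite mulrC -ltr_pdivlMr//.
    by have [_ + _] := tu n; rewrite !lt_min -!andbA => /and4P[].
  have xcvg : x @ \oo --> val u0 + f u0 *: v.
    apply/cvgrPdist_lt => b b0; have := klt _ (divr_gt0 b0 D0).
    apply: filterS => n; rewrite ltr_pdivlMr// mulrC distrC.
    apply: le_lt_trans; apply: le_trans (gdist _ (ud2 n)) _.
    by rewrite ler_pM2l// ltW//; have [_ + _] := tu n.
  have tcvg : t @ \oo --> 0.
    apply/cvgrPdist_lt => b b0; have := klt _ b0; apply: filterS => n.
    by rewrite sub0r normrN gtr0_norm//; apply: lt_trans; have [/andP[]] := tu n.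
  have [w wcvg wA] := Th x t xA xcvg t0 tcvg.
  have ycvg : (fun n => x n + t n *: w n) @ \oo --> val u0 + f u0 *: v.
    rewrite -[X in _ --> X]addr0 -(scale0r (val h + s *: v)).
    by apply: cvgD => //; exact: cvgZ.
  (* [K^-1] gives [|h' - h| <= 1], as [add_scale_near] requires; the other term makes replacing
     [(h', s')] by [(h, s)] cost at most [e * t n], against the choice of [t n] and [u n]. *)
  pose b := Num.min K^-1 (e / (K * (M + 1))).
  have KM0 : 0 < K * (M + 1) by rewrite mulr_gt0// ltr_wpDl// ltW.
  have b0 : 0 < b by rewrite lt_min invr_gt0 K0 divr_gt0.
  have [n [An [+ yd]]] := filter_ex (filterI wA (filterI
    (cvgr_dist_lt _ _ wcvg _ b0) (cvgr_dist_lt _ _ ycvg _ d0))).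
  have [h' [s' wE]] := hyperplane_decomp (w n) Ev.
  have yE : x n + t n *: w n = val (u n + t n *: h') + (f (u n) + t n * s') *: v.
    by rewrite wE scalerDr addrACA scalerA -scalerDl val_affine.
  rewrite wE => /=; set N := `|_ - _|; have [n1 n2] := near_u h h' s s'.
  rewrite -/N in n1 n2; rewrite lt_min => /andP[b1 b2].
  have [/andP[tn tk] uk] := tu n; apply/negP; rewrite -leNgt.
  have [tc uc] : t n < c /\ `|u n - u0| < c.
    move: tk uk; rewrite !lt_min -!andbA.
    by move=> /and4P[_ _ -> _] /and4P[_ _ -> _].
  have h'N : `|h'| <= `|h| + 1.
    rewrite -(subrK h h') addrC; apply: le_trans (ler_normD _ _) _.
    rewrite lerD2l distrC; apply: le_trans n1 _.
    by rewrite mulrC -ler_pdivlMr// div1r ltW.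
  rewrite distrC yE in yd; rewrite yE in An; have fE := (AP _ _ yd).1 An.
  have := lip _ _ (cP _ _ _ _ (introT andP (conj tn tc)) uc h'N)
    (cP _ _ _ h (introT andP (conj tn tc)) uc (ler_wpDr ler01 (lexx _))).
  rewrite opprD addrACA subrr add0r -scalerBr normrZ gtr0_norm// fE.
  rewrite ltr_pdivlMr// in b2.
  have := ler_wpM2l (mulr_ge0 (ltW M0) (ltW tn)) n1; rewrite [`|h - _|]distrC.
  have : t n * `|s - s'| <= t n * (K * N) by rewrite ler_pM2l.
  rewrite -[X in X * `|s - _|]gtr0_norm// -normrM.
  have : t n * (N * (K * (M + 1))) <= t n * e by rewrite ler_pM2l// ltW.
  rewrite !ler_norml => ? /andP[? ?] ? /andP[? ?].
  have : t n * (N * (K * (M + 1))) = M * t n * (K * N) + t n * (K * N) by ring.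
  by move=> ?; apply/andP; split; lra.
move=> x t xA xcvg t0 tcvg.
have /choice[u /choice[r xE]] n := hyperplane_decomp (x n) Ev.
(* With this slope, [x n + t n *: (val h + q n *: v)] lies exactly on the graph as soon as [x n]
   does. *)
pose q n := (f (u n + t n *: h) - f (u n)) / t n.
have ucvg k : 0 < k -> \forall n \near \oo, `|u n - u0| < k.
  move=> k0; near=> n.
  have : `|val u0 + f u0 *: v - x n| < k / K.
    by near: n; exact: cvgr_dist_lt xcvg _ (divr_gt0 k0 K0).
  rewrite xE distrC ltr_pdivlMr// mulrC => lt; apply: le_lt_trans lt.
  by have [] := near_u (u n) u0 (r n) (f u0).
have tlt k : 0 < k -> \forall n \near \oo, t n < k.
  by move=> k0; exact: cvgr_lt tcvg _ k0.
have qcvg : q @ \oo --> s.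
  apply/cvgrPdist_le => e e0; have [k k0 fk] := fh _ e0.
  near=> n; rewrite /q [_ / t n]mulrC ler_dist_quotient//; apply: fk.
    by rewrite t0; near: n; exact: tlt.
  by near: n; exact: ucvg.
have wcvg : (fun n => val h + q n *: v) @ \oo --> val h + s *: v.
  by apply: cvgD; [exact: cvg_cst|exact: cvgZr_tmp].
exists (fun n => val h + q n *: v) => //.
have ycvg : (fun n => x n + t n *: (val h + q n *: v)) @ \oo
    --> val u0 + f u0 *: v.
  rewrite -[X in _ --> X]addr0 -(scale0r (val h + s *: v)).
  by apply: cvgD => //; exact: cvgZ.
near=> n.
have xf : f (u n) = r n.
  apply/AP; rewrite -xE; last exact: xA.
  rewrite distrC.
  by near: n; exact: cvgr_dist_lt xcvg _ d0.
have yE : x n + t n *: (val h + q n *: v) =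
    val (u n + t n *: h) + f (u n + t n *: h) *: v.
  rewrite xE -xf scalerDr addrACA scalerA -scalerDl val_affine.
  by rewrite /q mulrCA divff ?gt_eqF// mulr1 addrCA subrr addr0.
rewrite yE; apply/AP => //; rewrite -yE distrC.
by near: n; exact: cvgr_dist_lt ycvg _ d0.
Unshelve. all: by end_near.
Qed.

(** * Graphs that are closed hyperplanes, and the equivalence *)

(* With [T] the graph of the strict directional derivative over its domain,
   [T] meets the line [R v] only at [0]; so if [T] has codimension one, it is a
   complement of [R v], and the domain is all of [E]. *)
Lemma graph_closed_hyperplane (R : realType) (X : normedModType R)
    (E : hyperplane X) (v : X) (f : E -> R) (u0 : E) (T : set X) :
  line_complement (hyperplane_set E) v ->
  locally_lipschitz_near (f : E -> R^o) u0 ->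
  (forall (h : E) (s : R),
    T (val h + s *: v) <-> strict_dderivative f u0 h s) ->
  strictly_hadamard_differentiable (f : E -> R^o) u0 <-> closed_hyperplane T.
Proof.
move=> Ev lipf TP; rewrite (strictly_hadamard_dderivative lipf).
have [M M0 fM] := strict_dderivative_norm lipf.
have [K K0 EK] := hyperplane_decomp_norm Ev.
have combE (a : R) (h k : E) (s r : R) : a *: (val h + s *: v) + (val k + r *: v) =
    val (a *: h + k) + (a * s + r) *: v.
  by rewrite linearP scalerDr addrACA scalerA -scalerDl.
split=> [[D cD Df]|[]].
  have TD (h : E) (s : R) : T (val h + s *: v) <-> s = D h.
    rewrite TP; split=> [fs|->]; last exact: Df.
    exact: (strict_dderivative_unique lipf fs (Df h)).
  split; last exists v; last split.
  - split.
      by rewrite inE -(addr0 0) -{1}(raddf0 (val : E -> X)) -(scale0r v) TD raddf0.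
    move=> a x y; have [h [s ->]] := hyperplane_decomp x Ev.
    have [k [r ->]] := hyperplane_decomp y Ev; rewrite !inE combE !TD => -> ->.
    by rewrite linearP.
  - move=> x clx; have [h [s xE]] := hyperplane_decomp x Ev.
    rewrite xE in clx *; apply/TD/eqP; rewrite -subr_eq0 -normr_le0.
    apply/ler_addgt0Pr => e e0; rewrite add0r.
    (* A point of [T] at distance [N] forces [|s - D h| <= K * N + M * (K * N)], by comparison with
       its own derivative [D k]. *)
    have KM0 : 0 < K * (1 + M) by rewrite mulr_gt0// ltr_wpDr// ltW.
    have [y [+ +]] := clx _ (nbhsx_ballx _ _ (divr_gt0 e0 KM0)).
    have [k [r ->]] := hyperplane_decomp y Ev; rewrite TD => ->.
    rewrite -ball_normE/= ltr_pdivlMr//; set N := `|_ - _| => NE.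
    have [n1 n2] := EK (h - k) (s - D k).
    have NN : `|val (h - k) + (s - D k) *: v| = N.
      by rewrite raddfB scalerBl addrACA -opprD.
    rewrite NN in n1 n2.
    have n3 := ler_wpM2l (ltW M0) n1; have n4 := fM _ _ _ _ (Df h) (Df k).
    apply: le_trans (ler_distD (D k) _ _) _; rewrite [`|D k - _|]distrC.
    have : N * (K * (1 + M)) = K * N + M * (K * N) by ring.
    lra.
  - exact: Ev.1.
  move=> x; have [h [s ->]] := hyperplane_decomp x Ev.
  exists (val h + D h *: v, s - D h); split=> /=.
    by split; [exact/TD|rewrite -addrA -scalerDl [D h + _]addrC subrK].
  move=> [y r] /= []; have [k [q ->]] := hyperplane_decomp y Ev.
  rewrite TD => -> /esym; rewrite -addrA -scalerDl => /(hyperplane_decomp_inj Ev)[-> <-].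
  by rewrite addrAC subrr add0r.
move=> [T0 Tlin] _ [w [w0 wP]].
have {}Tlin (a : R) x y : T x -> T y -> T (a *: x + y).
  by move=> Tx Ty; have := Tlin a x y; rewrite !inE; exact.
(* [T v] would make 1 a strict derivative in the direction 0, where it is 0. *)
have nTv : ~ T v.
  move=> Tv; have /TP f01 : T (val (0 : E) + 1 *: v) by rewrite raddf0 add0r scale1r.
  have := strict_dderivative_unique lipf f01 (strict_dderivative0 f u0).
  by move/eqP; rewrite oner_eq0.
(* Since [v = p + c *: w] with [c != 0], [v] can replace [w] as a complement: if
   [val h = q + d *: w], subtracting [(d / c) *: v] cancels [w] and leaves a point of [T] above
   [h]. *)
have [[p c] [/= [Tp vE] _]] := wP v.
have c0 : c != 0.
  by apply/eqP => c0; apply: nTv; rewrite vE c0 scale0r addr0.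
have /choice[D Df] (h : E) : exists s, strict_dderivative f u0 h s.
  have [[q d] [/= [Tq hE] _]] := wP (val h).
  exists (- (d / c)); apply/TP.
  have -> : val h + - (d / c) *: v = - (d / c) *: p + q.
    rewrite (hE : val h = _) vE scalerDr scalerA mulNr divfK// [- d *: w]scaleNr.
    by rewrite addrACA subrr addr0 addrC.
  exact: Tlin.
have Dlin : linear (D : E -> R^o).
  move=> a h k; apply: (strict_dderivative_unique lipf (Df _)).
  by apply/TP; rewrite -combE; apply: Tlin; exact/TP.
pose L : {linear E -> R^o} := HB.pack (D : E -> R^o)
  (GRing.isLinear.Build R E R^o *:%R (D : E -> R^o) Dlin).
exists L => // h A /nbhs_normP[e /= e0 eA]; apply/nbhs_normP.
exists (e / M) => /= [|k]; first exact: divr_gt0.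
rewrite /ball_/= ltr_pdivlMr// mulrC => kM; apply: eA => /=.
exact: le_lt_trans (fM _ _ _ _ (Df h) (Df k)) kM.
Qed.

(** The right-hand side does not mention [rho], so the equivalence also shows that the choice of
    local representation is immaterial. *)
Theorem theorem4p4 (R : realType) (X : completeNormedModType R)
    (S : set X) (xbar : X)
    (S_closed : closed S) (xbar_bdry : bdry S xbar)
    (S_epi : epi_lipschitzian S xbar)
    (rho : local_representation S xbar) :
  strictly_hadamard_differentiable_set rho <->
  closed_hyperplane (clarke_tangent_cone (bdry S) xbar).
Proof.
have Ev := lr_complement rho; have lipf := lr_lipschitz rho.
have [d d0 dP] := local_representation_bdry rho S_closed.
have [u0 [r0 xE]] := hyperplane_decomp xbar Ev.
(* As a boundary point, [xbar] lies on the graph, which is the form of base point that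
   [clarke_tangent_cone_graph] takes. *)
have fu0 : lr_fun u0 = r0 by apply/dP; rewrite -xE ?subrr ?normr0.
rewrite /strictly_hadamard_differentiable_set.
have projE : hyperplane_proj (lr_hyperplane rho) (lr_dir rho) xbar = u0.
  by have := hyperplane_projE u0 r0 Ev; rewrite -xE.
rewrite projE in lipf *; apply: (graph_closed_hyperplane Ev lipf) => h s.
have := @clarke_tangent_cone_graph _ _ _ _ _ (bdry S) _ _ h s Ev lipf d0.
by rewrite fu0 -xE; apply=> u r; exact: dP.
Qed.
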